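(* Let $\zeta=e^{2\pi i/13}$ and $\sqrt{13}>0$. Let $$S=-\frac{1}{\sqrt{13}}\begin{pmatrix} \zeta^{12}-\zeta & \zeta^{10}-\zeta^3 & \zeta^4-\zeta^9 & \zeta^5-\zeta^8 & \zeta^2-\zeta^{11} & \zeta^6-\zeta^7\\ \zeta^{10}-\zeta^3 & \zeta^4-\zeta^9 & \zeta^{12}-\zeta & \zeta^2-\zeta^{11} & \zeta^6-\zeta^7 & \zeta^5-\zeta^8\\ \zeta^4-\zeta^9 & \zeta^{12}-\zeta & \zeta^{10}-\zeta^3 & \zeta^6-\zeta^7 & \zeta^5-\zeta^8 & \zeta^2-\zeta^{11}\\ \zeta^5-\zeta^8 & \zeta^2-\zeta^{11} & \zeta^6-\zeta^7 & \zeta-\zeta^{12} & \zeta^3-\zeta^{10} & \zeta^9-\zeta^4\\ \zeta^2-\zeta^{11} & \zeta^6-\zeta^7 & \zeta^5-\zeta^8 & \zeta^3-\zeta^{10} & \zeta^9-\zeta^4 & \zeta-\zeta^{12}\\ \zeta^6-\zeta^7 & \zeta^5-\zeta^8 & \zeta^2-\zeta^{11} & \zeta^9-\zeta^4 & \zeta-\zeta^{12} & \zeta^3-\zeta^{10} \end{pmatrix}$$ and $T=\mathrm{diag}(\zeta^7,\zeta^{11},\zeta^8,\zeta^6,\zeta^2,\zeta^5)$. Let $G$ be the subgroup of $PGL(6,\mathbb{C})$ (acting on $\mathbb{P}^5$) generated by the images of $S$ and $T$. Then $G\cong PSL(2,13)$.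
   Context: Matrices in $GL(6,\mathbb{C})$ are regarded as projective transformations of $\mathbb{P}^5=\{(z_1,\dots,z_6)\}$, i.e. via their images in $PGL(6,\mathbb{C})$; relations between them are understood up to scalar multiples of the identity. *)

(* Defs.v *)
From HB Require Import structures.
From mathcomp Require Import all_boot all_order all_algebra all_fingroup all_solvable.
From mathcomp Require Import generic_quotient complex ring lra.
From mathcomp Require Import boolp classical_sets functions reals trigo.
Set Implicit Arguments.
Unset Strict Implicit.
Unset Printing Implicit Defensive.
Import Order.TTheory GRing.Theory Num.Theory.
Local Open Scope ring_scope.
Local Open Scope quotient_scope.
Local Open Scope complex_scope.
Local Open Scope classical_set_scope.

Section Subgroups.
Variable G : groupType.
Local Open Scope group_scope.

Definition subgroup (H : set G) : Prop :=
  [/\ H 1, (forall x y, H x -> H y -> H (x * y)) & (forall x, H x -> H x^-1)].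

Definition generated_subgroup (X : set G) : set G := smallest subgroup X.

End Subgroups.

Definition isomorphic_subgroups (G1 G2 : groupType) (A : set G1) (B : set G2) :=
  exists f : G1 -> G2,
    set_bij A B f /\
    (forall x y, A x -> A y -> f (x * y)%g = (f x * f y)%g).

Section ProjectiveLinearGroup.
Variables (n : nat) (F : fieldType).

(* The library's {'GL_n[F]} is only available over finite rings. *)
Record GL := MkGL { GLmx :> 'M[F]_n; GLmxP : GLmx \in unitmx }.
HB.instance Definition _ := [isSub for GLmx].
HB.instance Definition _ := [Choice of GL by <:].

Definition GL1 : GL := MkGL (unitmx1 F n).
Fact GLmul_subproof (A B : GL) : A *m B \in unitmx.
Proof. by rewrite unitmx_mul !GLmxP. Qed.
Definition GLmul (A B : GL) : GL := MkGL (GLmul_subproof A B).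
Fact GLinv_subproof (A : GL) : invmx A \in unitmx.
Proof. by rewrite unitmx_inv GLmxP. Qed.
Definition GLinv (A : GL) : GL := MkGL (GLinv_subproof A).

Fact GLmulA : associative GLmul.
Proof. by move=> A B C; apply: val_inj; rewrite /= mulmxA. Qed.
Fact GLmul1 : left_id GL1 GLmul.
Proof. by move=> A; apply: val_inj; rewrite /= mul1mx. Qed.
Fact GLmulr1 : right_id GL1 GLmul.
Proof. by move=> A; apply: val_inj; rewrite /= mulmx1. Qed.
Fact GLmulV : left_inverse GL1 GLinv GLmul.
Proof. by move=> A; apply: val_inj; rewrite /= mulVmx ?GLmxP. Qed.
Fact GLmulrV : right_inverse GL1 GLinv GLmul.
Proof. by move=> A; apply: val_inj; rewrite /= mulmxV ?GLmxP. Qed.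
HB.instance Definition _ := isGroup.Build GL GLmulA GLmul1 GLmulr1 GLmulV GLmulrV.

(* A and B are identified when A B^-1 is a scalar matrix. *)
Definition proportional : rel GL := fun A B => is_scalar_mx (A *m invmx B).

Lemma proportionalP (A B : GL) :
  reflect (exists2 c, c != 0 & GLmx A = c *: GLmx B) (proportional A B).
Proof.
apply: (iffP is_scalar_mxP) => [[c Ec]|[c nz_c ->]]; last first.
  by exists c; rewrite -scalemxAl mulmxV ?GLmxP // scalemx1.
have EA : GLmx A = c *: GLmx B by rewrite -mul_scalar_mx -Ec mulmxKV ?GLmxP.
have [c0|nz_c] := eqVneq c 0; last by exists c.
have A0 : GLmx A = 0 by rewrite EA c0 scale0r.
exists 1; rewrite ?oner_neq0 // scale1r A0 -[RHS]mulmx1 -(mulVmx (GLmxP A)).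
by rewrite A0 !mulmx0.
Qed.

Fact proportional_refl : reflexive proportional.
Proof. by move=> A; apply/proportionalP; exists 1; rewrite ?oner_neq0 ?scale1r. Qed.
Fact proportional_sym : symmetric proportional.
Proof.
suff H A B : proportional A B -> proportional B A by move=> A B; apply/idP/idP; apply: H.
case/proportionalP=> c nz_c E; apply/proportionalP; exists c^-1; rewrite ?invr_eq0 //.
by rewrite E scalerA mulVf ?scale1r.
Qed.
Fact proportional_trans : transitive proportional.
Proof.
move=> B A C /proportionalP[c nz_c EA] /proportionalP[d nz_d EB].
by apply/proportionalP; exists (c * d); rewrite ?mulf_neq0 // EA EB scalerA.
Qed.

Canonical proportional_equiv :=
  EquivRel proportional proportional_refl proportional_sym proportional_trans.

Definition PGL := {eq_quot proportional}.
HB.instance Definition _ := Choice.on PGL.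
HB.instance Definition _ := EqQuotient.on PGL.

Definition PGL1 : PGL := \pi_PGL GL1.
Definition PGLmul : PGL -> PGL -> PGL := lift_op2 PGL GLmul.
Definition PGLinv : PGL -> PGL := lift_op1 PGL GLinv.

Fact pi_PGLmul : {morph \pi_PGL : A B / GLmul A B >-> PGLmul A B}.
Proof.
move=> A B; unlock PGLmul; apply/eqP; rewrite eqmodE; apply/proportionalP.
have /eqmodP/proportionalP[c nz_c EA] : repr (\pi_PGL A) = A %[mod PGL] by rewrite reprK.
have /eqmodP/proportionalP[d nz_d EB] : repr (\pi_PGL B) = B %[mod PGL] by rewrite reprK.
exists (c * d)^-1; first by rewrite invr_eq0 mulf_neq0.
rewrite /= EA EB -scalemxAl -scalemxAr !scalerA -mulrA mulVf ?scale1r //.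
by rewrite mulf_neq0.
Qed.
Fact pi_PGLinv : {morph \pi_PGL : A / GLinv A >-> PGLinv A}.
Proof.
move=> A; unlock PGLinv; apply/eqP; rewrite eqmodE; apply/proportionalP.
have /eqmodP/proportionalP[c nz_c EA] : repr (\pi_PGL A) = A %[mod PGL] by rewrite reprK.
by exists c; rewrite //= EA invmxZ ?scalerA ?mulfV ?scale1r // -EA GLmxP.
Qed.

Fact PGLmulA : associative PGLmul.
Proof.
by elim/quotW=> A; elim/quotW=> B; elim/quotW=> C; rewrite -!pi_PGLmul GLmulA.
Qed.
Fact PGLmul1 : left_id PGL1 PGLmul.
Proof. by elim/quotW=> A; rewrite -pi_PGLmul GLmul1. Qed.
Fact PGLmulr1 : right_id PGL1 PGLmul.
Proof. by elim/quotW=> A; rewrite -pi_PGLmul GLmulr1. Qed.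
Fact PGLmulV : left_inverse PGL1 PGLinv PGLmul.
Proof. by elim/quotW=> A; rewrite -pi_PGLinv -pi_PGLmul GLmulV. Qed.
Fact PGLmulrV : right_inverse PGL1 PGLinv PGLmul.
Proof. by elim/quotW=> A; rewrite -pi_PGLinv -pi_PGLmul GLmulrV. Qed.
HB.instance Definition _ :=
  isGroup.Build PGL PGLmulA PGLmul1 PGLmulr1 PGLmulV PGLmulrV.

Definition to_PGL (A : GL) : PGL := \pi_PGL A.

End ProjectiveLinearGroup.

Section ProjectiveSpecialLinearGroup.
Variables (n : nat) (F : finFieldType).
Local Open Scope group_scope.

Definition SL : {set {'GL_n[F]}} := [set A : {'GL_n[F]} | \det (GLval A) == 1%R]%SET.

Fact SL_group_set : group_set SL.
Proof.
apply/group_setP; split=> [|A B]; rewrite !inE ?GL_1E ?det1 //.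
by rewrite GL_ME det_mulmx => /eqP-> /eqP->; rewrite mulr1.
Qed.
Canonical SL_group := Group SL_group_set.

Definition PSL : {set coset_of 'Z(SL)} := SL / 'Z(SL).

End ProjectiveSpecialLinearGroup.

Definition mx_of_rows (F : fieldType) (n : nat) (s : seq (seq F)) : 'M[F]_n :=
  \matrix_(i, j) nth 0 (nth [::] s i) j.

Section Generators.
Variable R : realType.

(* exp (2 pi i / 13) *)
Definition zeta : R[i] := cos (2 * pi / 13) +i* sin (2 * pi / 13).
Local Notation z := zeta.

Definition Smx : 'M[R[i]]_6 := - (Num.sqrt (13 : R))%:C^-1 *: mx_of_rows 6
  [:: [:: z^+12 - z;    z^+10 - z^+3; z^+4 - z^+9;  z^+5 - z^+8;  z^+2 - z^+11; z^+6 - z^+7];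
      [:: z^+10 - z^+3; z^+4 - z^+9;  z^+12 - z;    z^+2 - z^+11; z^+6 - z^+7;  z^+5 - z^+8];
      [:: z^+4 - z^+9;  z^+12 - z;    z^+10 - z^+3; z^+6 - z^+7;  z^+5 - z^+8;  z^+2 - z^+11];
      [:: z^+5 - z^+8;  z^+2 - z^+11; z^+6 - z^+7;  z - z^+12;    z^+3 - z^+10; z^+9 - z^+4];
      [:: z^+2 - z^+11; z^+6 - z^+7;  z^+5 - z^+8;  z^+3 - z^+10; z^+9 - z^+4;  z - z^+12];
      [:: z^+6 - z^+7;  z^+5 - z^+8;  z^+2 - z^+11; z^+9 - z^+4;  z - z^+12;    z^+3 - z^+10]].

Definition Tmx : 'M[R[i]]_6 :=
  diag_mx (\row_j nth 0 [:: z^+7; z^+11; z^+8; z^+6; z^+2; z^+5] j).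

Lemma zetaX k :
  z ^+ k = cos (2 * pi / 13 * k%:R) +i* sin (2 * pi / 13 * k%:R).
Proof.
elim: k => [|k IHk]; first by rewrite mulr0 cos0 sin0.
rewrite exprSr IHk /zeta; move: (2 * pi / 13) => t.
have -> : t * k.+1%:R = t * k%:R + t by rewrite -natr1 mulrDr mulr1.
rewrite cosD sinD.
by apply/eqP; rewrite eq_complex /= eqxx addrC eqxx.
Qed.

Lemma zeta13 : z ^+ 13 = 1.
Proof.
rewrite zetaX divfK ?pnatr_eq0 // mulrC mulr_natr cos2pi.
by rewrite sin2pi.
Qed.

Lemma zeta_neq1 : z != 1.
Proof.
rewrite eq_complex /= negb_and; apply/orP; right.
have p := @pi_gt0 R; rewrite gt_eqF // sin_gt0_pi //.
by rewrite divr_gt0 ?mulr_gt0 //= ltr_pdivrMr // mulrC ltr_pM2l // ltr_nat.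
Qed.

Lemma zeta12 : z ^+ 12 = - (1 + z + z^+2 + z^+3 + z^+4 + z^+5 + z^+6 + z^+7
  + z^+8 + z^+9 + z^+10 + z^+11).
Proof.
apply: (@mulfI _ (z - 1)); first by rewrite subr_eq0 zeta_neq1.
by have H := zeta13; ring: H.
Qed.

Lemma Smx_unit : Smx \in unitmx.
Proof.
have nz13 : (Num.sqrt (13 : R))%:C != 0 :> R[i].
  by rewrite eq_complex /= negb_and sqrtr_eq0 -ltNge ltr0n.
rewrite unitmxZ ?unitfE ?oppr_eq0 ?invr_eq0 //.
set M := mx_of_rows _ _.
suff E : M *m M = (-13)%:M.
  have: M *m M \in unitmx.
    by rewrite E unitmxE det_scalar unitfE expf_neq0 // oppr_eq0 pnatr_eq0.
  by rewrite unitmx_mul => /andP[].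
have H := zeta12.
apply/matrixP=> i j; rewrite !mxE !big_ord_recl big_ord0 !mxE /=.
move: zeta H => x H.
case: i => [[|[|[|[|[|[|i]]]]]] Hi] //; case: j => [[|[|[|[|[|[|j]]]]]] Hj] //=;
 rewrite -?[_ == _]/false -?[_ == _]/true ?mulr0n ?mulr1n; ring: H.
Qed.

Lemma Tmx_unit : Tmx \in unitmx.
Proof.
have z0 : z != 0.
  by apply/eqP=> z0; have := zeta13; rewrite z0 expr0n /= => /esym/eqP; rewrite oner_eq0.
rewrite unitmxE det_diag unitfE; apply/prodf_neq0 => i _; rewrite mxE.
by case: i => [[|[|[|[|[|[|i]]]]]] Hi] //=; rewrite expf_neq0.
Qed.

Definition S_GL : GL 6 R[i] := MkGL Smx_unit.
Definition T_GL : GL 6 R[i] := MkGL Tmx_unit.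

End Generators.

(* Main.v *)
Require Import Defs.
From mathcomp Require Import all_boot all_order all_algebra all_fingroup all_solvable.
From mathcomp Require Import classical_sets reals complex generic_quotient ring.

(* Index the six coordinates by the residues 1, 3, 9, 8, 11, 7 modulo 13, which
   represent the nonzero residues up to sign; C^6 is then the space of odd
   functions on F_13.  In these coordinates S is the discrete Fourier transform
   and T the chirp psi (x^2 / 2), where psi x = zeta^x: this is the odd part of
   the Weil representation.  The symmetrized Weyl operators W_v = W_(-v), for v
   in F_13^2, satisfy S W_v = W_(s v) S and T W_v = W_(t v) T, where s and t
   generate SL(2, 13).  A matrix commuting with every W_v is scalar, and an
   element of SL(2, 13) that fixes every W_v is 1 or -1.  Hence the relation
   "A W_v = W_(g v) A for all v" is the graph of an isomorphism from the group
   generated by S and T in PGL(6, C) onto SL(2, 13) / {1, -1}. *)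

Set Implicit Arguments.
Unset Strict Implicit.
Unset Printing Implicit Defensive.
Import Order.TTheory GRing.Theory Num.Theory.
Local Open Scope ring_scope.
Local Open Scope complex_scope.
Local Open Scope quotient_scope.

(** * The additive character of F_13 and the entries of S and T *)

Section OddWeilRepresentation.
Variable R : realType.
Local Notation C := (R[i]).
Local Notation K := 'F_13.

Definition psi (x : K) : C := zeta R ^+ x.

Lemma psiD x y : psi (x + y) = psi x * psi y.
Proof. by rewrite /psi -exprD /= -[RHS](expr_mod _ (zeta13 R)). Qed.

Lemma psi0 : psi 0 = 1.
Proof. by rewrite /psi expr0. Qed.

Lemma psi_neq0 x : psi x != 0.
Proof.
apply/eqP=> p0; have := psi0.
by rewrite -(subrr x) psiD p0 mul0r => /esym/eqP; rewrite oner_eq0.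
Qed.

Lemma psi_eq1 x : psi x = 1 -> x = 0.
Proof.
have psiM n : psi (x *+ n) = psi x ^+ n.
  by elim: n => [|n IHn]; rewrite ?psi0 // mulrS psiD IHn exprS.
move=> p1; apply/eqP/negPn/negP => x0.
(* Raising psi x = 1 to the power x^-1 gives psi 1 = zeta = 1. *)
have := psiM ((x^-1 : K) : nat); rewrite p1 expr1n -mulr_natr natr_Zp mulfV //.
by rewrite /psi expr1 => /eqP; rewrite (negbTE (zeta_neq1 R)).
Qed.

Lemma psi_inj : injective psi.
Proof.
move=> x y exy; apply/eqP; rewrite -subr_eq0; apply/eqP/psi_eq1.
by rewrite psiD exy -psiD subrr psi0.
Qed.

(* Representatives of the nonzero residues up to sign, in the order of the
   coordinates for which T is the chirp psi (x ^ 2 / 2). *)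
Definition rep (i : 'I_6) : K := nth 0 [:: 1; 3; 9; 8; 11; 7]%R i.

Definition odd_psi (x : K) : C := psi x - psi (- x).

(** On odd functions, the terms y and -y of the Fourier kernel psi (x y) combine into
    [odd_psi (x * y)]. The minus sign of S turns zeta^12 - zeta into [odd_psi 1]. *)
Lemma SmxE i j :
  Smx R i j = (Num.sqrt (13 : R))%:C^-1 * odd_psi (rep i * rep j).
Proof.
rewrite !mxE mulNr -mulrN; congr (_ * _).
by case: i => [[|[|[|[|[|[|i]]]]]] Hi] //; case: j => [[|[|[|[|[|[|j]]]]]] Hj] //=;
  rewrite /odd_psi /psi /rep /= ?expr1 opprB.
Qed.

Lemma TmxE i j : Tmx R i j = psi (7 * rep i ^+ 2) *+ (i == j).
Proof.
rewrite !mxE; congr (_ *+ _).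
by case: i => [[|[|[|[|[|[|i]]]]]] Hi].
Qed.

End OddWeilRepresentation.

(** * Weyl operators and their transformation under S and T *)

Section WeylOperators.
Variable R : realType.
Local Notation C := (R[i]).
Local Notation K := 'F_13.
Local Notation psi := (@psi R).
Local Notation odd_psi := (@odd_psi R).

Lemma sum_K (f : K -> C) :
  \sum_z f z = f 0 + \sum_i (f (rep i) + f (- rep i)).
Proof.
have fN n : (n <= 13)%N -> f (- n%:R) = f (13 - n)%:R.
  move=> le_n; rewrite natrB //; congr f.
  by rewrite -[LHS]add0r; congr (_ - _); apply/val_inj.
rewrite (eq_bigr (fun z : 'I_13 => f (z : nat)%:R)); last first.
  by move=> z _; rewrite natr_Zp.
rewrite !big_ord_recl !big_ord0 /rep /= /bump /= (fN 1%N) // (fN 3%N) // (fN 9%N) // (fN 8%N) // (fN 11%N) // (fN 7%N) //=.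
by rewrite !addr0 !add1n; ring.
Qed.

Lemma odd_psiN x : odd_psi (- x) = - odd_psi x.
Proof. by rewrite /odd_psi opprK opprB. Qed.

(** With y = [rep i], the coefficient of the i-th coordinate in the evaluation of an odd function at
    x. *)
Definition odd_delta (x y : K) : C := (x == y)%:R - (x == - y)%:R.

(* The Weyl operators f |-> psi (b x + a b / 2) f (x + a) of (a, b) and
   (- a, - b), summed so as to preserve the odd functions on F_13; the factor 7
   is 1 / 2 modulo 13. *)
Definition weyl (v : 'cV[K]_2) : 'M[C]_6 := \matrix_(i, j)
  (psi (v 1 0 * rep i + 7 * v 0 0 * v 1 0) * odd_delta (rep i + v 0 0) (rep j)
   + psi (- v 1 0 * rep i + 7 * v 0 0 * v 1 0) * odd_delta (rep i - v 0 0) (rep j)).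

Lemma weylN v : weyl (- v) = weyl v.
Proof.
by apply/matrixP=> i j; rewrite !mxE addrC !(mulrN, mulNr) !opprK.
Qed.

Lemma sum_odd_delta (h : K -> C) x : (forall y, h (- y) = - h y) ->
  \sum_i odd_delta x (rep i) * h (rep i) = h x.
Proof.
move=> hN; have h0 : h 0 = 0.
  have /eqP : h 0 *+ 2 = 0 by rewrite mulr2n -{2}oppr0 hN subrr.
  by rewrite mulrn_eq0 => /eqP.
rewrite [RHS](_ : _ = \sum_z (x == z)%:R * h z); last first.
  rewrite (bigD1 x) //= eqxx mul1r big1 ?addr0 // => z /negbTE.
  by rewrite eq_sym => ->; rewrite mul0r.
rewrite sum_K h0 mulr0 add0r; apply: eq_bigr => i _.
by rewrite hN /odd_delta; ring.
Qed.

(** The summand of (-a, -b) at z is the summand of (a, b) at -z, so the sum over the six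
    representatives unfolds to a sum over F_13 of the latter alone. There [odd_delta] selects z =
    rep j - a and z = - rep j - a. *)
Lemma sum_odd_psi_weyl (x a b : K) j :
  \sum_i odd_psi (x * rep i) *
    (psi (b * rep i + 7 * a * b) * odd_delta (rep i + a) (rep j)
   + psi (- b * rep i + 7 * a * b) * odd_delta (rep i - a) (rep j)) =
  odd_psi (x * (rep j - a)) * psi (b * (rep j - a) + 7 * a * b)
  - odd_psi (x * (- rep j - a)) * psi (b * (- rep j - a) + 7 * a * b).
Proof.
pose f z := odd_psi (x * z) * (psi (b * z + 7 * a * b) * odd_delta (z + a) (rep j)).
transitivity (\sum_z f z).
  rewrite sum_K {1}/f mulr0 /odd_psi oppr0 subrr mul0r add0r.
  apply: eq_bigr => i _; rewrite /f mulrDr; congr (_ + _).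
  rewrite mulrN odd_psiN [b * - _]mulrN -[- (b * _)]mulNr /odd_delta.
  have sub_oppl y : (- rep i + a == y) = (rep i - a == - y).
    by rewrite -eqr_oppLR opprD opprK.
  by rewrite !sub_oppl opprK /odd_psi; ring.
have sel (y : K) (F : K -> C) : \sum_z F z * (z + a == y)%:R = F (y - a).
  rewrite (bigD1 (y - a)) //= subrK eqxx mulr1 big1 ?addr0 // => z /negbTE zn.
  by rewrite [_ == y]eq_sym -subr_eq eq_sym zn mulr0.
rewrite -(sel (rep j) (fun z => odd_psi (x * z) * psi (b * z + 7 * a * b))).
rewrite -(sel (- rep j) (fun z => odd_psi (x * z) * psi (b * z + 7 * a * b))).
rewrite -sumrB; apply: eq_bigr => z _; rewrite /f /odd_delta; ring.
Qed.

(** Since 7 stands for 1 / 2, exponents agree only after 14 becomes 1; c supplies the multiple of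
    13, leaving a goal for [ring]. *)
Lemma eq_mod13 (c x y : K) : x - y = c * 13 -> x = y.
Proof.
rewrite (_ : 13 = 0 :> K) ?mulr0; last exact/val_inj.
by move/eqP; rewrite subr_eq0 => /eqP.
Qed.

Definition weyl_coords (a b : K) : 'cV[K]_2 := \col_i (if i == 0 then a else b).

Lemma Smx_weyl (v : 'cV[K]_2) :
  Smx R *m weyl v = weyl (weyl_coords (- v 1 0) (v 0 0)) *m Smx R.
Proof.
set a := v 0 0; set b := v 1 0.
apply/matrixP=> i j; rewrite !mxE.
pose r : C := (Num.sqrt (13 : R))%:C^-1.
have hN (z : K) : odd_psi (- z * rep j) = - odd_psi (z * rep j).
  by rewrite mulNr odd_psiN.
under eq_bigr => k _ do rewrite SmxE -mulrA !mxE.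
rewrite -mulr_sumr sum_odd_psi_weyl.
transitivity (r * (psi (a * rep i + 7 * (- b) * a) * odd_psi ((rep i - b) * rep j)
  + psi (- a * rep i + 7 * (- b) * a) * odd_psi ((rep i + b) * rep j))).
  congr (_ * _); rewrite /odd_psi !mulrBl !mulrBr -!psiD.
  (* The four characters are paired by the sign of a * rep i in the exponent. *)
  have swap (x y z t : C) : x - y - (z - t) = t - y + (x - z) by ring.
  rewrite swap; congr (psi _ - psi _ + (psi _ - psi _));
    by apply: (@eq_mod13 (a * b)); rewrite /a /b; ring.
(* Each column of S is an odd function of the row residue, so its values at rep i - b and rep i + b
   expand in the coordinates. *)
rewrite -(sum_odd_delta (rep i - b) hN) -(sum_odd_delta (rep i + b) hN).
rewrite !mulr_sumr -big_split mulr_sumr; apply: eq_bigr => k _ /=.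
by rewrite SmxE !mxE /= opprK -/r; ring.
Qed.

Lemma Tmx_weyl (v : 'cV[K]_2) :
  Tmx R *m weyl v = weyl (weyl_coords (v 0 0) (v 1 0 - v 0 0)) *m Tmx R.
Proof.
apply/matrixP=> i j; rewrite !mxE.
rewrite (bigD1 i) //= big1 ?addr0; last first.
  by move=> k /negbTE ki; rewrite TmxE eq_sym ki mul0r.
rewrite (bigD1 j) //= [X in _ = _ + X]big1 ?addr0; last first.
  by move=> k /negbTE kj; rewrite TmxE kj mulr0.
rewrite !TmxE !eqxx !mulr1n !mxE /=; set a := v 0 0; set b := v 1 0.
(* The chirp is even and [odd_delta x (rep j)] is supported on x = rep j and x = - rep j. *)
have chirp x : odd_delta x (rep j) * psi (7 * rep j ^+ 2) =
    odd_delta x (rep j) * psi (7 * x ^+ 2).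
  rewrite /odd_delta; have [->|_] := eqVneq x (rep j) => //.
  have [->|_] := eqVneq x (- rep j) => //; first by rewrite sqrrN.
  by rewrite subrr !mul0r.
(* The cross term 14 a rep i of the square equals a rep i; this shifts b to b - a. *)
have e1 : psi (7 * rep i ^+ 2) * psi (b * rep i + 7 * a * b) =
    psi ((b - a) * rep i + 7 * a * (b - a)) * psi (7 * (rep i + a) ^+ 2).
  by rewrite -!psiD; congr psi; apply: (@eq_mod13 (- a * rep i)); ring.
have e2 : psi (7 * rep i ^+ 2) * psi (- b * rep i + 7 * a * b) =
    psi (- (b - a) * rep i + 7 * a * (b - a)) * psi (7 * (rep i - a) ^+ 2).
  by rewrite -!psiD; congr psi; apply: (@eq_mod13 (a * rep i)); ring.
rewrite [LHS]mulrDr [RHS]mulrDl [in LHS]mulrA e1 [X in _ + X]mulrA e2.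
by congr (_ + _); rewrite -[LHS]mulrA -[RHS]mulrA chirp; congr (_ * _);
  apply: mulrC.
Qed.

End WeylOperators.

Lemma det_mx22 (F : comNzRingType) (A : 'M[F]_2) :
  \det A = A 0 0 * A 1 1 - A 0 1 * A 1 0.
Proof.
rewrite (expand_det_row _ 0) !big_ord_recl big_ord0 addr0 /cofactor !det_mx11.
rewrite !mxE /= expr0 expr1 mul1r mulN1r mulrN.
by congr (A _ _ * A _ _ - A _ _ * A _ _); apply: val_inj.
Qed.

(** * The commutant of the Weyl operators and the stabilizer of all of them *)

Section WeylIrreducible.
Variable R : realType.
Local Notation C := (R[i]).
Local Notation K := 'F_13.
Local Notation psi := (@psi R).
Local Notation odd_delta := (@odd_delta R).
Local Notation weyl := (@weyl R).

Lemma rep_surj (x : K) : x != 0 -> exists i, x = rep i \/ x = - rep i.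
Proof.
case: x => [[|[|[|[|[|[|[|[|[|[|[|[|[|n]]]]]]]]]]]]] Hn] //= _;
  [exists (inZp 0)|exists (inZp 4)|exists (inZp 1)|exists (inZp 2)
  |exists (inZp 3)|exists (inZp 5)|exists (inZp 5)|exists (inZp 3)
  |exists (inZp 2)|exists (inZp 1)|exists (inZp 4)|exists (inZp 0)];
  solve [left; exact: val_inj | right; exact: val_inj].
Qed.

Lemma odd_delta_rep i j : odd_delta (rep i) (rep j) = (i == j)%:R.
Proof.
rewrite /odd_delta; have -> : (rep i == rep j) = (i == j).
  by case: i j => [[|[|[|[|[|[|i]]]]]] Hi] // [[|[|[|[|[|[|j]]]]]] Hj].
have -> : (rep i == - rep j) = false; last by rewrite subr0.
by case: i j => [[|[|[|[|[|[|i]]]]]] Hi] // [[|[|[|[|[|[|j]]]]]] Hj].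
Qed.

Lemma odd_delta0 j : odd_delta 0 (rep j) = 0.
Proof. by rewrite /odd_delta eq_sym [_ == - _]eq_sym oppr_eq0 subrr. Qed.

(** Translating row i by [rep i] and by its opposite gives 2 rep i and 0. The second contributes
    nothing, so the first yields a nonzero off-diagonal Weyl entry. *)
Lemma odd_delta_double i :
  exists2 j, i != j & odd_delta (rep i + rep i) (rep j) != 0.
Proof.
have nz (j : 'I_6) : (rep i + rep i == rep j) != (rep i + rep i == - rep j) ->
    odd_delta (rep i + rep i) (rep j) != 0.
  by rewrite /odd_delta subr_eq0 eqr_nat; move: (_ == rep j) (_ == - rep j) => [] [].
(* The list holds the index of 2 rep i up to sign. *)
exists (inZp (nth 0%N [:: 4; 5; 3; 1; 2; 0]%N i)).
  by case: i {nz} => [[|[|[|[|[|[|i]]]]]] Hi].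
by apply: nz; case: i => [[|[|[|[|[|[|i]]]]]] Hi].
Qed.

Definition even_psi (x : K) : C := psi x + psi (- x).

(** As psi y and psi (- y) have product 1, their sum determines them as the roots of a quadratic, of
    which psi x is a root too. *)
Lemma even_psi_eq x y : even_psi x = even_psi y -> x = y \/ x = - y.
Proof.
move=> exy; have : (psi x - psi y) * (psi x - psi (- y)) = 0.
  have px : psi x * psi (- x) = 1 by rewrite -psiD subrr psi0.
  have py : psi y * psi (- y) = 1 by rewrite -psiD subrr psi0.
  have -> : (psi x - psi y) * (psi x - psi (- y)) =
    psi x * (psi x - (psi y + psi (- y))) + psi y * psi (- y) by ring.
  by rewrite -/(even_psi y) -exy /even_psi py -px; ring.
move/eqP; rewrite mulf_eq0 !subr_eq0 => /orP[] /eqP/psi_inj; [by left|by right].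
Qed.

Lemma weyl_diag b i j :
  weyl (weyl_coords 0 b) i j = even_psi (b * rep i) *+ (i == j).
Proof.
rewrite !mxE /= mulr0 mul0r !addr0 subr0 mulNr odd_delta_rep -mulrDl.
by rewrite mulr_natr.
Qed.

Lemma rep_eq_sign i j : rep i = rep j \/ rep i = - rep j -> i = j.
Proof.
move=> e; apply/eqP/negPn/negP=> nij; move: e.
by case: i j nij => [[|[|[|[|[|[|i]]]]]] Hi] // [[|[|[|[|[|[|j]]]]]] Hj] // _ [].
Qed.

(* Commuting with the operator of (0, 1), which is diagonal with distinct
   eigenvalues, makes A diagonal; the operator of (1, 0) links the coordinates
   along the path 1 - 2 - 3 - 4 - 5 - 6. *)
Lemma weyl_commutant (A : 'M[C]_6) :
  (forall v, A *m weyl v = weyl v *m A) -> is_scalar_mx A.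
Proof.
move=> cA; have diagA i j : i != j -> A i j = 0.
  move=> nij; have /matrixP/(_ i j) := cA (weyl_coords 0 1).
  rewrite !mxE (bigD1 j) //= big1 ?addr0; last first.
    by move=> k /negbTE kj; rewrite weyl_diag kj mulr0.
  rewrite (bigD1 i) //= big1 ?addr0; last first.
    by move=> k /negbTE ki; rewrite weyl_diag eq_sym ki mul0r.
  rewrite !weyl_diag !eqxx !mulr1n !mul1r [RHS]mulrC => /eqP.
  rewrite -subr_eq0 -mulrBr mulf_eq0 => /orP[/eqP //|].
  rewrite subr_eq0 => /eqP/even_psi_eq/rep_eq_sign eji.
  by rewrite eji eqxx in nij.
(* The hypothesis says that the (i, j) entry of the operator of (1, 0) is nonzero, in a form decided
   by computation. *)
have link i j : ((rep i + 1 == rep j)%R + (rep i - 1 == rep j)%R !=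
    (rep i + 1 == - rep j)%R + (rep i - 1 == - rep j)%R)%N -> A i i = A j j.
  move=> nz; have /matrixP/(_ i j) := cA (weyl_coords 1 0).
  rewrite !mxE (bigD1 i) //= big1 ?addr0; last first.
    by move=> k ki; rewrite diagA ?mul0r // eq_sym.
  rewrite (bigD1 j) //= big1 ?addr0; last by move=> k kj; rewrite diagA ?mulr0.
  rewrite [RHS]mulrC => /mulIf; apply; rewrite !mxE /= mulr0 oppr0 !mul0r addr0.
  rewrite psi0 !mul1r /odd_delta addrACA -opprD -!natrD subr_eq0.
  by rewrite eqr_nat.
pose o k : 'I_6 := inZp k.
(* The indices 0, 4, 1, 2, 3, 5 carry the residues 1, 2, 3, 4, 5, 6 up to sign. *)
have e1 : A (o 0) (o 0) = A (o 4) (o 4) by exact: link.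
have e2 : A (o 4) (o 4) = A (o 1) (o 1) by exact: link.
have e3 : A (o 1) (o 1) = A (o 2) (o 2) by exact: link.
have e4 : A (o 2) (o 2) = A (o 3) (o 3) by exact: link.
have e5 : A (o 3) (o 3) = A (o 5) (o 5) by exact: link.
apply/is_scalar_mxP; exists (A (o 0) (o 0)); apply/matrixP=> i j; rewrite !mxE.
have [<-|/diagA //] := eqVneq; rewrite mulr1n.
have -> : i = o i by apply: val_inj; rewrite /= modn_small.
by case: i => [[|[|[|[|[|[|i]]]]]] Hi] //=; rewrite ?e1 ?e2 ?e3 ?e4 ?e5.
Qed.

Lemma weyl_shift_inj c :
  weyl (weyl_coords 1 c) = weyl (weyl_coords 1 0) -> c = 0.
Proof.
(* In the row of residue 1, translation by -1 lands on 0 and drops out; the other term compares psi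
   (c + 7 c) with 1. *)
move=> /matrixP ec; have [j _ nzd] := odd_delta_double 0.
have := ec 0 j; rewrite !mxE /= subrr odd_delta0 !mulr0 !addr0 mul0r.
move/(mulIf nzd); rewrite psi0 => /psi_eq1.
rewrite (_ : _ + _ = 8 * c); last by rewrite (_ : rep 0 = 1) //; ring.
by move/eqP; rewrite mulf_eq0 => /orP[] // /eqP.
Qed.

Lemma mul_weyl_coords (g : 'M[K]_2) a b : g *m weyl_coords a b =
  weyl_coords (g 0 0 * a + g 0 1 * b) (g 1 0 * a + g 1 1 * b).
Proof.
apply/colP=> i; rewrite !mxE !big_ord_recl big_ord0 !mxE /= addr0.
rewrite (_ : lift 0 0 = 1) //; last exact: val_inj.
by case: i => [[|[|i]] Hi] //=; congr (g _ _ * _ + g _ _ * _); exact: val_inj.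
Qed.

(** The operator of (0, 1) is diagonal, which forces g 0 1 = 0, and its eigenvalues give g 1 1 up to
    sign. The determinant then gives g 0 0, and the operator of (1, 0) gives g 1 0 = 0. *)
Lemma weyl_faithful (g : 'M[K]_2) : \det g = 1 ->
  (forall v, weyl (g *m v) = weyl v) -> g = 1%:M \/ g = - 1%:M.
Proof.
move=> detg fixg.
have g01 : g 0 1 = 0.
  apply/eqP/negPn/negP => nz01.
  have [i def_i] := rep_surj nz01; have [j nij nzd] := odd_delta_double i.
  have /matrixP/(_ i j) := fixg (weyl_coords 0 1).
  rewrite weyl_diag (negbTE nij) mul_weyl_coords !mulr0 !add0r !mulr1 !mxE /=.
  have nz x : psi x * odd_delta (rep i + rep i) (rep j) != 0.
    by rewrite mulf_neq0 ?psi_neq0.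
  case: def_i => -> /eqP.
    by rewrite subrr odd_delta0 mulr0 addr0 (negbTE (nz _)).
  by rewrite subrr odd_delta0 mulr0 add0r opprK (negbTE (nz _)).
have sg11 : g 1 1 = 1 \/ g 1 1 = -1.
  apply: even_psi_eq; have /matrixP/(_ 0 0) := fixg (weyl_coords 0 1).
  by rewrite mul_weyl_coords g01 mul0r !mulr0 !add0r !weyl_diag !mulr1.
have := fixg (weyl_coords 1 0); move: detg.
rewrite mul_weyl_coords det_mx22 g01 mul0r subr0 !mulr0 !addr0 !mulr1.
have eqg (h : 'M[K]_2) : g 0 0 = h 0 0 -> 0 = h 0 1 -> g 1 0 = h 1 0 ->
    g 1 1 = h 1 1 -> g = h.
  move=> e00 e01 e10 e11; apply/matrixP.
  have d2 (i : 'I_2) : i = 0 \/ i = 1.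
    by case: i => [[|[|i]] Hi] //; [left|right]; exact: val_inj.
  by move=> i j; case: (d2 i) (d2 j) => -> [] ->; rewrite ?g01.
case: sg11 => g11; rewrite g11 => e00 ew; [left|right].
  rewrite mulr1 in e00; rewrite e00 in ew.
  by apply: eqg; rewrite !mxE //= (weyl_shift_inj ew).
have {}e00 : g 0 0 = -1 by apply/eqP; rewrite -eqr_oppLR -mulrN1 e00.
have g10 : - g 1 0 = 0.
  apply: weyl_shift_inj; rewrite -ew -weylN e00; congr weyl.
  by apply/colP=> i; rewrite !mxE; case: (i == 0); rewrite ?opprK.
by apply: eqg; rewrite !mxE //= ?oppr0 // -[g 1 0]opprK g10 oppr0.
Qed.

End WeylIrreducible.

(** * Generators and centre of SL(2, 13) *)

Section SL2Generators.
Local Notation K := 'F_13.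

Definition mx22 (a b c d : K) : 'M[K]_2 :=
  \matrix_(i, j) if i == 0 then (if j == 0 then a else b)
                 else (if j == 0 then c else d).

Lemma mx22E (A : 'M[K]_2) : A = mx22 (A 0 0) (A 0 1) (A 1 0) (A 1 1).
Proof.
have d2 (i : 'I_2) : (i = 0 \/ i = 1).
  by case: i => [[|[|i]] Hi] //; [left|right]; exact: val_inj.
by apply/matrixP=> i j; case: (d2 i) (d2 j) => -> [] ->; rewrite !mxE.
Qed.

Lemma mul_mx22 a b c d a' b' c' d' :
  (mx22 a b c d *m mx22 a' b' c' d' =
   mx22 (a * a' + b * c') (a * b' + b * d') (c * a' + d * c') (c * b' + d * d')).
Proof.
apply/matrixP=> i j; rewrite !mxE !big_ord_recl big_ord0 !mxE /= addr0.
by case: (i == _); case: (j == _).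
Qed.

Lemma det_mx22E a b c d : (\det (mx22 a b c d) = a * d - b * c).
Proof. by rewrite det_mx22 !mxE. Qed.

Fact sl2S_unit : mx22 0 (-1) 1 0 \is a GRing.unit.
Proof. by rewrite -[_ \is a _]/(_ \in unitmx) unitmxE det_mx22E unitfE. Qed.
Fact sl2T_unit : mx22 1 0 (-1) 1 \is a GRing.unit.
Proof. by rewrite -[_ \is a _]/(_ \in unitmx) unitmxE det_mx22E unitfE. Qed.

Definition sl2S : {'GL_2[K]} := FinRing.Unit sl2S_unit.
Definition sl2T : {'GL_2[K]} := FinRing.Unit sl2T_unit.

Lemma sl2S_SL : sl2S \in SL 2 K.
Proof. by rewrite inE det_mx22E. Qed.

Lemma sl2T_SL : sl2T \in SL 2 K.
Proof. by rewrite inE det_mx22E. Qed.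

(** Powers of [sl2T] are the lower unitriangular matrices, and conjugation by [sl2S] makes them
    upper. A matrix with nonzero upper right entry is a product lower, upper, lower. *)
Lemma SL2_generated : SL 2 K \subset <<[set sl2S; sl2T]>>%g.
Proof.
set H := <<_>>%g; pose P (A : 'M[K]_2) := exists2 h, h \in H & GLval h = A.
have PM A B : P A -> P B -> P (A *m B).
  by move=> [g Hg <-] [h Hh <-]; exists (g * h)%g; rewrite ?groupM.
have PS : P (mx22 0 (-1) 1 0).
  by exists sl2S; rewrite // mem_gen // !inE eqxx.
have PT : P (mx22 1 0 (-1) 1).
  by exists sl2T; rewrite // mem_gen // !inE eqxx orbT.
have PSV : P (mx22 0 1 (-1) 0).
  have -> : mx22 0 1 (-1) 0 = mx22 0 (-1) 1 0 *m (mx22 0 (-1) 1 0 *m mx22 0 (-1) 1 0).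
    by rewrite !mul_mx22; congr mx22; exact: val_inj.
  by do 2!apply: (PM) => //.
have PL c : P (mx22 1 0 c 1).
  suff PLn n : P (mx22 1 0 (- n%:R) 1) by rewrite -[c]opprK -(natr_Zp (- c)).
  elim: n => [|n IHn].
    rewrite oppr0; exists 1%g; rewrite ?group1 // [LHS]mx22E.
    by congr mx22; rewrite !mxE.
  have -> : mx22 1 0 (- n.+1%:R) 1 = mx22 1 0 (-1) 1 *m mx22 1 0 (- n%:R) 1.
    by rewrite mul_mx22 -natr1; congr mx22; ring.
  exact: PM.
have PU b : P (mx22 1 b 0 1).
  have -> : mx22 1 b 0 1 =
      mx22 0 (-1) 1 0 *m mx22 1 0 (- b) 1 *m mx22 0 1 (-1) 0.
    by rewrite !mul_mx22; congr mx22; ring.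
  by do 2!apply: (PM) => //.
have PB a b c d : (a * d - b * c = 1 -> b != 0 -> P (mx22 a b c d)).
  move=> det1 nzb; have -> : mx22 a b c d =
      mx22 1 0 ((d - 1) / b) 1 *m mx22 1 b 0 1 *m mx22 1 0 ((a - 1) / b) 1.
    rewrite !mul_mx22; congr mx22; [by field|by ring| |by field].
    have -> : c = ((a * d - 1) / b).
      by rewrite -det1 opprB addrCA subrr addr0 mulrAC mulfV ?mul1r.
    by field.
  by do 2!apply: (PM) => //.
apply/fintype.subsetP=> g; rewrite inE => /eqP detg.
suff [h Hh /val_inj <- //] : P (GLval g).
move: detg; rewrite [GLval g]mx22E det_mx22E.
move: (GLval g 0 0) (GLval g 0 1) (GLval g 1 0) (GLval g 1 1) => a b c d det1.
have [b0|nzb] := eqVneq b 0; last exact: PB.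
(* Splitting off the inverse of [sl2S] moves - a to the upper right corner, nonzero because a d =
   1. *)
have -> : mx22 a b c d = mx22 b (- a) d (- c) *m mx22 0 1 (-1) 0.
  by rewrite mul_mx22; congr mx22; ring.
apply: PM => //; apply: PB; first by rewrite -det1; ring.
rewrite oppr_eq0; apply/eqP=> a0; move: det1.
by rewrite a0 b0 !mul0r subr0 => /esym/eqP; rewrite oner_eq0.
Qed.

(** Commuting with [sl2T] gives b = 0; commuting with [sl2S] then gives c = 0 and d = a, and the
    determinant gives a^2 = 1. *)
Lemma center_SL2 g :
  (g \in 'Z(SL 2 K)%g) = (GLval g == 1%:M) || (GLval g == - 1%:M).
Proof.
apply/idP/orP.
  case/setIP; rewrite inE => /eqP detg /centP cg.
  have cS : GLval g *m mx22 0 (-1) 1 0 = mx22 0 (-1) 1 0 *m GLval g.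
    exact: (congr1 (@GLval 2 K) (cg _ sl2S_SL : g * sl2S = sl2S * g)%g).
  have cT : GLval g *m mx22 1 0 (-1) 1 = mx22 1 0 (-1) 1 *m GLval g.
    exact: (congr1 (@GLval 2 K) (cg _ sl2T_SL : g * sl2T = sl2T * g)%g).
  move: detg cS cT; rewrite [GLval g]mx22E det_mx22E !mul_mx22.
  move: (GLval g 0 0) (GLval g 0 1) (GLval g 1 0) (GLval g 1 1) => a b c d.
  move=> detg /matrixP cS /matrixP cT.
  have := cT 0 0; rewrite !mxE /= !mulr1 mul1r mul0r addr0 mulrN1 => /eqP.
  rewrite -subr_eq0 addrAC subrr add0r oppr_eq0 => /eqP b0.
  have := cS 0 0; rewrite !mxE /= b0 !mulr0 !mul0r !add0r mulN1r => /esym/eqP.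
  rewrite oppr_eq0 => /eqP c0.
  have := cS 1 0; rewrite !mxE /= c0 !mulr0 !mulr1 !mul1r add0r addr0 => da.
  move/eqP: detg; rewrite da b0 mul0r subr0 -expr2 sqrf_eq1.
  by case/orP=> /eqP ->; [left|right]; rewrite [X in _ == X]mx22E !mxE ?oppr0.
move=> g1; apply/setIP; split.
  rewrite inE; case: g1 => /eqP ->; rewrite ?det1 //.
  by rewrite det_mx22 !mxE.
apply/centP=> h _; apply: val_inj.
change (GLval g *m GLval h = GLval h *m GLval g).
by case: g1 => /eqP ->; rewrite ?mulNmx ?mulmxN mul1mx mulmx1.
Qed.

End SL2Generators.

(** * The intertwining relation between PGL(6, C) and SL(2, 13) *)

Section Intertwiners.
Variable R : realType.
Local Notation C := (R[i]).
Local Notation K := 'F_13.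
Local Notation weyl := (@weyl R).

Definition intertwines (A : 'M[C]_6) (g : 'M[K]_2) :=
  forall v, A *m weyl v = weyl (g *m v) *m A.

Lemma intertwines1 : intertwines 1%:M 1%:M.
Proof. by move=> v; rewrite !mul1mx mulmx1. Qed.

Lemma intertwinesM A B g h :
  intertwines A g -> intertwines B h -> intertwines (A *m B) (g *m h).
Proof. by move=> Ag Bh v; rewrite -mulmxA Bh mulmxA Ag !mulmxA. Qed.

Lemma intertwinesV A g : A \in unitmx -> g \in unitmx ->
  intertwines A g -> intertwines (invmx A) (invmx g).
Proof.
move=> uA ug Ag v; have := Ag (invmx g *m v); rewrite mulKVmx // => e.
by rewrite -[LHS](mulmxK uA) -(mulmxA (invmx A)) -e mulKmx.
Qed.

Lemma intertwinesZ c A g : intertwines A g -> intertwines (c *: A) g.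
Proof. by move=> Ag v; rewrite -scalemxAl Ag scalemxAr. Qed.

Lemma weyl_coordsE (v : 'cV[K]_2) : v = weyl_coords (v 0 0) (v 1 0).
Proof.
apply/colP=> i; rewrite mxE; case: i => [[|[|i]] Hi] //=;
  by congr (v _ _); exact: val_inj.
Qed.

Lemma intertwines_S : intertwines (Smx R) (GLval sl2S).
Proof.
move=> v; rewrite Smx_weyl; congr (weyl _ *m _).
by rewrite [in RHS](weyl_coordsE v) mul_weyl_coords !mxE /=; congr weyl_coords; ring.
Qed.

Lemma intertwines_T : intertwines (Tmx R) (GLval sl2T).
Proof.
move=> v; rewrite Tmx_weyl; congr (weyl _ *m _).
by rewrite [in RHS](weyl_coordsE v) mul_weyl_coords !mxE /=; congr weyl_coords; ring.
Qed.

(** The relation is invariant under scaling, so the chosen representative of p is immaterial. *)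
Definition PGL_intertwines (p : PGL 6 C) (g : {'GL_2[K]}) :=
  intertwines (GLmx (repr p)) (GLval g).

Lemma to_PGL_intertwines (A : GL 6 C) (g : {'GL_2[K]}) :
  intertwines A (GLval g) -> PGL_intertwines (to_PGL A) g.
Proof.
move=> Ag; have /eqmodP/proportionalP[c _ E] :
  repr (to_PGL A) = A %[mod PGL 6 C] by rewrite reprK.
by rewrite /PGL_intertwines E; apply: intertwinesZ.
Qed.

Lemma PGL_intertwines1 : PGL_intertwines 1%g 1%g.
Proof. exact/to_PGL_intertwines/intertwines1. Qed.

Lemma PGL_intertwinesM p q g h : PGL_intertwines p g ->
  PGL_intertwines q h -> PGL_intertwines (p * q)%g (g * h)%g.
Proof.
move=> pg qh; rewrite -[p]reprK -[q]reprK -[(_ * _)%g]pi_PGLmul.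
exact/to_PGL_intertwines/intertwinesM.
Qed.

Lemma PGL_intertwinesV p g :
  PGL_intertwines p g -> PGL_intertwines p^-1%g g^-1%g.
Proof.
move=> pg; rewrite -[p]reprK -[(_ ^-1)%g]pi_PGLinv.
apply: to_PGL_intertwines.
exact: (intertwinesV (GLmxP (repr p)) (GL_unitmx g) pg).
Qed.

(** The quotient of p by q intertwines the identity, so it commutes with every Weyl operator and is
    scalar. *)
Lemma PGL_intertwines_injl p q g :
  PGL_intertwines p g -> PGL_intertwines q g -> p = q.
Proof.
move=> pg qg; rewrite -[p]reprK -[q]reprK.
apply/eqmodP; apply: weyl_commutant => v.
have uq := GLmxP (repr q).
have := intertwinesM pg (intertwinesV uq (GL_unitmx g) qg) v.
by rewrite (mulmxV (GL_unitmx g)) (mul1mx v).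
Qed.

(** The identity, as p times its inverse, intertwines g h^-1, which therefore fixes every Weyl
    operator. *)
Lemma PGL_intertwines_injr p g h : g \in SL 2 K -> h \in SL 2 K ->
  PGL_intertwines p g -> PGL_intertwines p h -> (g * h^-1 \in 'Z(SL 2 K))%g.
Proof.
move=> Sg Sh pg ph.
have := intertwinesM pg (intertwinesV (GLmxP (repr p)) (GL_unitmx h) ph).
rewrite mulmxV ?GLmxP // => e.
rewrite center_SL2 -[GLval _]/(GLval g *m invmx (GLval h)).
have [||->|->] := @weyl_faithful R (GLval g *m invmx (GLval h)).
- by have := groupM Sg (groupVr Sh); rewrite inE => /eqP.
- by move=> v; have := e v; rewrite mul1mx mulmx1.
- by rewrite eqxx.
- by rewrite eqxx orbT.
Qed.

End Intertwiners.

Lemma generated_subgroup_subgroup (G : groupType) (X : set G) :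
  subgroup (generated_subgroup X).
Proof.
split=> [H [[H1 _ _] _] //|x y Gx Gy H HX|x Gx H HX].
  by have [[_ HM _] _] := HX; apply: HM; [apply: Gx|apply: Gy].
by have [[_ _ HV] _] := HX; apply: HV; apply: Gx.
Qed.

(** * The map from the generated group to PSL(2, 13) *)

Section ProjectiveAction.
Variable R : realType.
Local Notation C := (R[i]).
Local Notation K := 'F_13.
Local Notation G :=
  (generated_subgroup [set to_PGL (S_GL R); to_PGL (T_GL R)])%classic.

(** The elements related to some g in SL(2, 13) form a subgroup containing both generators. *)
Lemma generated_intertwines p :
  G p -> exists2 g, g \in SL 2 K & PGL_intertwines p g.
Proof.
move=> /(_ [set q | exists2 g, g \in SL 2 K & PGL_intertwines q g]%classic).
apply; split=> [|q [] ->]; last first.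
- by exists sl2T; [apply: sl2T_SL | apply/to_PGL_intertwines/intertwines_T].
- by exists sl2S; [apply: sl2S_SL | apply/to_PGL_intertwines/intertwines_S].
split=> [|x y [g Sg xg] [h Sh yh]|x [g Sg xg]].
- by exists 1%g; rewrite ?group1 //; apply: PGL_intertwines1.
- by exists (g * h)%g; rewrite ?groupM //; apply: PGL_intertwinesM.
- by exists g^-1%g; rewrite ?groupV //; apply: PGL_intertwinesV.
Qed.

Lemma SL2_intertwines g :
  g \in SL 2 K -> exists2 p, G p & PGL_intertwines p g.
Proof.
have [G1 GM GV] := generated_subgroup_subgroup
  [set to_PGL (S_GL R); to_PGL (T_GL R)]%classic.
have GX q : [set to_PGL (S_GL R); to_PGL (T_GL R)]%classic q -> G q.
  by move=> Xq H [_]; apply.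
(* A word in [sl2S] and [sl2T] is lifted letter by letter. *)
move/(fintype.subsetP SL2_generated)/gen_prodgP => [n [c cX ->]].
elim/big_ind: _ => [|g1 g2 [p1 Gp1 pg1] [p2 Gp2 pg2]|i _].
- by exists 1%g => //; apply: PGL_intertwines1.
- by exists (p1 * p2)%g; [apply: GM | apply: PGL_intertwinesM].
have := cX i; rewrite !inE => /orP[] /eqP ->.
- by exists (to_PGL (S_GL R)); [apply: GX; left|apply/to_PGL_intertwines/intertwines_S].
- by exists (to_PGL (T_GL R)); [apply: GX; right|apply/to_PGL_intertwines/intertwines_T].
Qed.

(** By [PGL_intertwines_injr] the coset does not depend on the g picked. The default 1 arises only
    when no g is related to p, hence never on the generated group. *)
Definition projective_action (p : PGL 6 C) : coset_of 'Z(SL 2 K)%g :=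
  coset _ (xget 1%g [set g | g \in SL 2 K /\ PGL_intertwines p g]%classic).

Lemma projective_actionE p g : g \in SL 2 K -> PGL_intertwines p g ->
  projective_action p = coset _ g.
Proof.
move=> Sg pg; rewrite /projective_action; case: xgetP => [h _ [Sh ph]|/(_ g) []//].
have nZ : SL 2 K \subset 'N('Z(SL 2 K))%g := normal_norm (center_normal _).
apply/rcoset_kercosetP; rewrite ?(fintype.subsetP nZ) // mem_rcoset.
exact: PGL_intertwines_injr ph pg.
Qed.

End ProjectiveAction.

Theorem theorem3p1 (R : realType) :
  isomorphic_subgroups
    (generated_subgroup [set to_PGL (S_GL R); to_PGL (T_GL R)])%classic
    [set` PSL 2 'F_13]%classic.
Proof.
have nZ : SL 2 'F_13 \subset 'N('Z(SL 2 'F_13))%g := normal_norm (center_normal _).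
exists (@projective_action R); split; last first.
  move=> p q /generated_intertwines[g Sg pg] /generated_intertwines[h Sh qh].
  rewrite (projective_actionE Sg pg) (projective_actionE Sh qh).
  rewrite (projective_actionE (groupM Sg Sh) (PGL_intertwinesM pg qh)).
  by rewrite morphM ?(fintype.subsetP nZ).
split=> [p /generated_intertwines[g Sg pg]|p q|x].
- by rewrite /= (projective_actionE Sg pg) mem_quotient.
- move=> /set_mem/generated_intertwines[g Sg pg] /set_mem/generated_intertwines[h Sh qh].
  rewrite (projective_actionE Sg pg) (projective_actionE Sh qh).
  move/rcoset_kercosetP; rewrite !(fintype.subsetP nZ) // mem_rcoset center_SL2 => /(_ isT isT) gh.
  (* Equal cosets mean g = h or g = - h; as W_v = W_(-v), q is then related to g as well. *)
  apply: PGL_intertwines_injl pg _ => v; rewrite qh; congr (_ *m _).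
  have -> : GLval g *m v = GLval (g * h^-1)%g *m (GLval h *m v).
    rewrite mulmxA -[GLval _ *m GLval h]/(GLval (g * h^-1 * h)%g).
    by rewrite mulgKV.
  by case/orP: gh => /eqP ->; rewrite ?mulNmx ?weylN mul1mx.
case/morphimP=> g _ Sg ->; have [p Gp pg] := SL2_intertwines R Sg.
by exists p => //; apply: projective_actionE.
Qed.
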